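(* Let $k\in\mathbb{N}$, and let $f_j:\mathbb{R}_+\to\mathbb{R}$ be strictly increasing for $j\in\{0,1,\dots,k\}$. Then the following conditions are equivalent. (a) For all $n\in\mathbb{N}$ and for all $(x_{1,1},\dots,x_{1,k}),\dots,(x_{n,1},\dots,x_{n,k})\in\mathbb{R}_+^k$, $$A^{[n]}_{f_0}\big(x_{1,1}+\dots+x_{1,k},\dots,x_{n,1}+\dots+x_{n,k}\big)\leq A^{[n]}_{f_1}(x_{1,1},\dots,x_{n,1})+\dots+A^{[n]}_{f_k}(x_{1,k},\dots,x_{n,k}).$$ (b) For all $n\in\mathbb{N}$, for all $(x_{1,1},\dots,x_{1,k}),\dots,(x_{n,1},\dots,x_{n,k})\in\mathbb{R}_+^k$, and for all $(\lambda_1,\dots,\lambda_n)\in\Lambda_n$, $$\widetilde{A}^{[n]}_{f_0}\big(x_{1,1}+\dots+x_{1,k},\dots,x_{n,1}+\dots+x_{n,k};\lambda_1,\dots,\lambda_n\big)\leq \widetilde{A}^{[n]}_{f_1}(x_{1,1},\dots,x_{n,1};\lambda_1,\dots,\lambda_n)+\dots+\widetilde{A}^{[n]}_{f_k}(x_{1,k},\dots,x_{n,k};\lambda_1,\dots,\lambda_n).$$ (c) For all $(x_1,\dots,x_k),(y_1,\dots,y_k)\in\mathbb{R}_+^k$, $$A^{[2]}_{f_0}\big(x_1+\dots+x_k,\,y_1+\dots+y_k\big)\leq A^{[2]}_{f_1}(x_1,y_1)+\dots+A^{[2]}_{f_k}(x_k,y_k).$$ (d) The functions $f_0,f_1,\dots,f_k$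 are continuous and the function $\Psi:f_1(\mathbb{R}_+)\times\dots\times f_k(\mathbb{R}_+)\to\mathbb{R}$ defined by $$\Psi(u_1,\dots,u_k):=f_0\big(f_1^{-1}(u_1)+\dots+f_k^{-1}(u_k)\big)$$ is concave.
   Context: Conventions: $\mathbb{N}=\{1,2,\dots\}$; $\mathbb{R}_+=(0,\infty)$; ''increasing'' means nondecreasing (as opposed to ''strictly increasing''). $\operatorname{conv}(S)$ is the convex hull of $S\subseteq\mathbb{R}$. Weights: $\Lambda_n:=[0,\infty)^n\setminus\{(0,\dots,0)\}$. Generalized inverse: if $J\subseteq\mathbb{R}$ is a nonempty open interval and $f:J\to\mathbb{R}$ is strictly increasing (not necessarily continuous), then there is a unique increasing function $f^{(-1)}:\operatorname{conv}(f(J))\to J$ with $f^{(-1)}(f(x))=x$ for all $x\in J$; it is called the generalized inverse of $f$ (it is continuous and satisfies $f(f^{(-1)}(y))=y$ for $y\in f(J)$). Generalized quasi-arithmetic means: for such $f$ and $n\in\mathbb{N}$, $$A^{[n]}_{f}(x_1,\dots,x_n):=f^{(-1)}\Big(\frac{f(x_1)+\dots+f(x_n)}{n}\Big)\quad ((x_1,\dots,x_n)\in J^n),$$ $$\widetilde{A}^{[n]}_{f}(x_1,\dots,x_n;\lambda_1,\dots,\lambda_n):=f^{(-1)}\Big(\frac{\lambda_1f(x_1)+\dots+\lambda_nf(x_n)}{\lambda_1+\dots+\lambda_n}\Big)\quad ((x_1,\dots,x_n)\in J^n,\ (\lambda_1,\dots,\lambda_n)\in\Lambda_n).$$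
   Formalization: For k = 1 it is additionally assumed that f_0 or f_1 is continuous: the printed claim fails for k = 1 and f_0 = f_1 discontinuous, where (a), (b), (c) hold trivially and (d) fails; for k ≥ 2 nothing is changed. *)

(* Defs.v *)
From mathcomp Require Import all_boot all_order all_algebra.
From mathcomp Require Import ring lra.
From mathcomp Require Import all_classical all_reals all_analysis.
Set Implicit Arguments.
Unset Strict Implicit.
Unset Printing Implicit Defensive.
Import Order.TTheory GRing.Theory Num.Theory.
Import numFieldNormedType.Exports.
Local Open Scope classical_set_scope.
Local Open Scope ring_scope.

Definition Rpos (R : realType) : set R := [set x | 0 < x].
Arguments Rpos : clear implicits.

Definition strictly_increasing_on (R : realType) (J : set R) (f : R -> R) :=
  {in J &, {homo f : x y / x < y}}.

Definition conv_hull (R : realType) (S : set R) : set R :=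
  smallest (@convex_set R R^o) S.

(* Functions with domain D are represented by total functions; only their
   values on D matter. *)
Definition is_geninv (R : realType) (J : set R) (f g : R -> R) :=
  [/\ forall y, conv_hull (f @` J) y -> J (g y),
      {in conv_hull (f @` J) &, {homo g : y z / y <= z}}
    & {in J, cancel f g}].

(* [geninvP] and [is_geninv_unique] below: this is well defined on
   conv(f(J)), and arbitrary outside. *)
Definition geninv (R : realType) (J : set R) (f : R -> R) : R -> R :=
  xget (fun=> 0) (is_geninv J f).

Definition qamean (R : realType) (J : set R) (f : R -> R) (n : nat)
    (x : n.-tuple R) : R :=
  geninv J f ((\sum_(i < n) f (tnth x i)) / n%:R).

Definition weights (R : realType) (n : nat) : set (n.-tuple R) :=
  [set l | (forall i, 0 <= tnth l i) /\ l <> [tuple 0 | i < n]].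
Arguments weights : clear implicits.

Definition wqamean (R : realType) (J : set R) (f : R -> R) (n : nat)
    (x l : n.-tuple R) : R :=
  geninv J f ((\sum_(i < n) tnth l i * f (tnth x i)) / \sum_(i < n) tnth l i).

(* The counterpart of the library's [convex_function]; like it, it does not
   by itself require D to be convex. *)
Definition concave_function (R : realType) (k : nat) (D : set 'rV[R]_k)
    (F : 'rV[R]_k -> R) :=
  forall t : R, 0 <= t <= 1 ->
    {in D &, forall u v, t * F u + (1 - t) * F v <= F (t *: u + (1 - t) *: v)}.

(* f ord0 is f_0, and f (lift ord0 j), j < k, are f_1, ..., f_k. *)
Definition Psi_dom (R : realType) (k : nat) (f : 'I_k.+1 -> R -> R) :
    set 'rV[R]_k :=
  [set u | forall j, (f (lift ord0 j) @` Rpos R) (u ord0 j)].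

Definition Psi (R : realType) (k : nat) (f : 'I_k.+1 -> R -> R)
    (u : 'rV[R]_k) : R :=
  f ord0 (\sum_(j < k)
    'pinv_(fun=> 0) (Rpos R) (f (lift ord0 j)) (u ord0 j)).

Lemma conv_hullE (R : realType) (S : set R) :
  conv_hull S = [set` Rhull S].
Proof.
rewrite Rhull_smallest /conv_hull; congr (smallest _ S).
apply/funext => A; apply/propext; split => [cA x y Ax Ay z /andP[xz zy]|iA].
  have [xy|yx] := ltP x y; last first.
    have -> : z = x by apply/le_anti/andP; split=> //; exact: le_trans zy yx.
    exact: Ax.
  have d0 : 0 < y - x by rewrite subr_gt0.
  have t0 : 0 <= (y - z) / (y - x) by rewrite divr_ge0 ?subr_ge0// ltW.
  have t1 : (y - z) / (y - x) <= 1 by rewrite ler_pdivrMr// mul1r lerD2l lerN2.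
  have := cA x y (Itv01 t0 t1); rewrite !inE => /(_ Ax Ay) Aw.
  suff <- : (y - z) / (y - x) * x + (1 - (y - z) / (y - x)) * y = z by [].
  by field; rewrite gt_eqF.
move=> x y t; rewrite !inE => Ax Ay.
have [xy|/ltW yx] := leP x y.
  apply: (iA x y Ax Ay); exact: (@convR_itv R x y t xy).
rewrite convC; apply: (iA y x Ay Ax).
exact: (@convR_itv R y x (1 - t%:num)%:i01 yx).
Qed.

Lemma conv_hullP (R : realType) (S : set R) (y : R) :
  conv_hull S y <-> exists a b, [/\ S a, S b & a <= y <= b].
Proof.
rewrite conv_hullE Rhull_smallest; split.
  move=> /(_ [set y | exists a b, [/\ S a, S b & a <= y <= b]]); apply.
  split => [u v [a [b [Sa Sb /andP[au ub]]]] [c [d [Sc Sd /andP[cv vd]]]]|x Sx].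
    move=> w /andP[uw wv]; exists a, d; split => //.
    by rewrite (le_trans au uw) (le_trans wv vd).
  by exists x, x; rewrite lexx; split.
move=> [a [b [Sa Sb ayb]]] A [iA SA].
exact: (iA a b (SA _ Sa) (SA _ Sb)).
Qed.

Lemma is_geninv_unique (R : realType) (J : set R) (f g h : R -> R) :
  is_interval J -> is_geninv J f g -> is_geninv J f h ->
  {in conv_hull (f @` J), g =1 h}.
Proof.
move=> iJ.
suff H g1 g2 : is_geninv J f g1 -> is_geninv J f g2 ->
    {in conv_hull (f @` J), forall y, g1 y <= g2 y}.
  by move=> Hg Hh y yH; apply/le_anti; rewrite !H.
move=> [g1J g1m g1K] [g2J g2m g2K] y yH; rewrite leNgt; apply/negP => c.
have yH' : conv_hull (f @` J) y by rewrite inE in yH.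
pose z := (g2 y + g1 y) / 2.
have [zl zr] : g2 y < z /\ z < g1 y by rewrite /z; split; lra.
have zJ : z \in J.
  by rewrite inE; apply: (iJ (g2 y) (g1 y)); [exact: g2J|exact: g1J|rewrite !ltW].
have fzH : f z \in conv_hull (f @` J).
  rewrite inE; apply/conv_hullP; exists (f z), (f z); rewrite lexx.
  by split=> //; exists z => //; rewrite inE in zJ.
have [fzy|/ltW yfz] := leP (f z) y.
  by have := g2m _ _ fzH yH fzy; rewrite g2K// leNgt zl.
by have := g1m _ _ yH fzH yfz; rewrite g1K// leNgt zr.
Qed.

Lemma geninvP (R : realType) (J : set R) (f : R -> R) :
  is_interval J -> strictly_increasing_on J f -> is_geninv J f (geninv J f).
Proof.
move=> iJ fs; rewrite /geninv; apply: xgetPex.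
have fm x y : J x -> J y -> f x <= f y -> x <= y.
  move=> Jx Jy; rewrite !leNgt; apply: contra => yx.
  by apply: fs => //; rewrite inE.
pose L y := [set x | J x /\ f x <= y].
have Lub y b : J b -> y <= f b -> ubound (L y) b.
  by move=> Jb yb x [Jx fx]; apply: fm => //; exact: le_trans fx yb.
have Lsup y : conv_hull (f @` J) y -> has_sup (L y).
  move=> /conv_hullP[_ [_ [[a Ja <-] [b Jb <-] /andP[ay yb]]]].
  by split; [exists a|exists b; exact: Lub].
exists (fun y => sup (L y)); split => [y yH|y z yH zH yz|x xJ].
- have /conv_hullP[_ [_ [[a Ja <-] [b Jb <-] /andP[ay yb]]]] := yH.
  apply: (iJ a b) => //; apply/andP; split.
    by apply: ub_le_sup; [exact: (Lsup y yH).2|split].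
  by apply: ge_sup; [exists a|exact: Lub].
- rewrite inE in yH; rewrite inE in zH.
  apply: ge_sup; first exact: (Lsup y yH).1.
  move=> x [Jx fx]; apply: ub_le_sup; first exact: (Lsup z zH).2.
  by split => //; exact: le_trans fx yz.
- rewrite inE in xJ; apply/le_anti/andP; split.
    by apply: ge_sup; [exists x|exact: Lub].
  by apply: ub_le_sup; [exists x; exact: Lub|split].
Qed.

(* Main.v *)
Require Import Defs.
From mathcomp Require Import all_boot all_order all_algebra.
From mathcomp Require Import ring lra.
From mathcomp Require Import all_classical all_reals all_analysis.
Set Implicit Arguments.
Unset Strict Implicit.
Unset Printing Implicit Defensive.
Import Order.TTheory GRing.Theory Num.Theory.
Import numFieldNormedType.Exports.
Local Open Scope classical_set_scope.
Local Open Scope ring_scope.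

(** The four conditions are tied together through the two-point inequality (c),
    which is the weakest of the mean inequalities: it is the case n = 2 of (a),
    and (a) is (b) with unit weights.  So everything rests on (c) implying (d)
    and (d) implying (b).

    For (d) implying (b), continuity makes each image f_j(R_+) an interval, on
    which the generalized inverse is the true inverse.  Hence Psi_dom is convex,
    and Jensen's inequality for Psi ([jensen]) at the points
    (f_1(x_i1), ..., f_k(x_ik)) is (b) with f_0 applied to both sides.

    For (c) implying continuity, moving one addend and fixing the others turns
    (c) into a comparison of a two-point mean of f_0 near the sum p with a
    two-point mean of f_j near its addend a ([mean_dominated]).  A jump of an
    increasing function at a point pins to that point all means of two values
    taken just around it, whereas at a point of continuity the mean moves as
    soon as one of the two values does.  Playing one behaviour against the
    other, f_0 is continuous at p exactly when f_j is continuous at a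
    ([addend_continuousP]).  When k >= 2, a single continuity point a of f_1,
    which exists because a monotone function has countably many jumps, is then
    enough: every other f_j with j >= 1 and every z > 0, placed as addends z and
    a of one sum, show f_j to be continuous at z; from there continuity passes
    to f_0 and to f_1.  When k = 1 there is no second addend to carry this
    propagation, which is why continuity of one of the two functions is assumed.

    For (c) implying concavity, once all f_j are continuous (c) says that Psi is
    midpoint concave; along a segment Psi is continuous, and a continuous
    midpoint concave function of one variable lies above its chords
    ([midpoint_concave_chord]). *)

(** * Convex hulls, barycenters and generalized inverses *)

Lemma Rpos_itv (R : realType) : is_interval (Rpos R).
Proof. by move=> x y x0 y0 z /andP[xz _]; exact: lt_le_trans xz. Qed.

Lemma open_Rpos (R : realType) : open (Rpos R).
Proof. exact: open_gt. Qed.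

Lemma incr_le (R : realType) (f : R -> R) (x y : R) :
  strictly_increasing_on (Rpos R) f -> 0 < x -> x <= y -> f x <= f y.
Proof.
move=> fs x0; rewrite le_eqVlt => /predU1P[->//|xy].
by apply/ltW/fs => //; rewrite inE /Rpos //=; exact: lt_trans xy.
Qed.

Lemma incr_lt (R : realType) (f : R -> R) (x y : R) :
  strictly_increasing_on (Rpos R) f -> 0 < x -> x < y -> f x < f y.
Proof.
by move=> fs x0 xy; apply: fs => //; rewrite inE /Rpos //=; exact: lt_trans xy.
Qed.

(** Induction on the number of points: split off the first one and join it to
    the barycenter of the others.  This applies to subsets of R (hulls) as well
    as to hypographs (Jensen). *)
Lemma convex_barycenter (R : realType) (E : lmodType R) (C : set E) :
  (forall u v t, 0 <= t <= 1 -> C u -> C v -> C (t *: u + (1 - t) *: v)) ->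
  forall n (l : 'I_n -> R) (v : 'I_n -> E),
    (forall i, 0 <= l i) -> (forall i, C (v i)) -> 0 < \sum_i l i ->
    C ((\sum_i l i)^-1 *: \sum_i l i *: v i).
Proof.
move=> cC; elim=> [|n IH] l v l0 Cv; first by rewrite big_ord0 ltxx.
rewrite !big_ord_recl; set s := \sum_(i < n) _; set w := \sum_(i < n) _ => sum0.
have : 0 <= s by exact: sumr_ge0.
rewrite le_eqVlt => /predU1P[s0|s0].
  (* The remaining points carry no weight, hence have no barycenter. *)
  have li0 (i : 'I_n) : l (lift ord0 i) = 0.
    by apply/eqP; have /psumr_eq0P -> := esym s0.
  rewrite /w big1 => [|i _]; last by rewrite li0 scale0r.
  rewrite -s0 !addr0 in sum0 *.
  by rewrite scalerA mulVf ?scale1r ?gt_eqF.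
pose t := l ord0 / (l ord0 + s).
have -> : (l ord0 + s)^-1 *: (l ord0 *: v ord0 + w) =
    t *: v ord0 + (1 - t) *: (s^-1 *: w).
  rewrite scalerDr !scalerA mulrC; congr (_ + _ *: _).
  by rewrite /t; field; rewrite !gt_eqF.
apply: cC => //; last exact: IH.
have ls0 : 0 < l ord0 + s by exact: ltr_wpDl.
by rewrite divr_ge0 ?(ltW ls0)//= ler_pdivrMr// mul1r lerDl ltW.
Qed.

Lemma hull_itv (R : realType) (S : set R) : is_interval (conv_hull S).
Proof. by rewrite conv_hullE; exact: interval_is_interval. Qed.

Lemma hull_sub (R : realType) (S : set R) (y : R) : S y -> conv_hull S y.
Proof. by move=> Sy; apply/conv_hullP; exists y, y; rewrite lexx. Qed.

Lemma itv_convex (R : realType) (S : set R) (u v t : R) :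
  is_interval S -> 0 <= t <= 1 -> S u -> S v -> S (t * u + (1 - t) * v).
Proof.
move=> iS t01 Su Sv; have [uv|/ltW vu] := leP u v.
  by apply: (iS u v) => //; apply/andP; split; nra.
by apply: (iS v u) => //; apply/andP; split; nra.
Qed.

Lemma hull_mean (R : realType) (S : set R) (n : nat) (l v : 'I_n -> R) :
  (forall i, 0 <= l i) -> (forall i, S (v i)) -> 0 < \sum_i l i ->
  conv_hull S ((\sum_i l i * v i) / \sum_i l i).
Proof.
move=> l0 Sv s0; rewrite mulrC.
apply: (@convex_barycenter R R^o (conv_hull S)) => // [u w t t01 Su Sw|i].
  exact: (@itv_convex R _ u w t (@hull_itv R S)).
exact: hull_sub.
Qed.

Lemma geninvK (R : realType) (f : R -> R) (x : R) :
  strictly_increasing_on (Rpos R) f -> 0 < x -> geninv (Rpos R) f (f x) = x.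
Proof.
move=> fs x0; have [_ _] := geninvP (@Rpos_itv R) fs.
by apply; rewrite inE.
Qed.

Lemma geninv_gt0 (R : realType) (f : R -> R) (y : R) :
  strictly_increasing_on (Rpos R) f ->
  conv_hull (f @` Rpos R) y -> 0 < geninv (Rpos R) f y.
Proof. by move=> fs Hy; have [H _ _] := geninvP (@Rpos_itv R) fs; exact: H. Qed.

Lemma hull_val (R : realType) (f : R -> R) (x : R) :
  0 < x -> conv_hull (f @` Rpos R) (f x).
Proof. by move=> x0; apply: hull_sub; exists x. Qed.

Lemma geninv_le (R : realType) (f : R -> R) (x y : R) :
  strictly_increasing_on (Rpos R) f -> conv_hull (f @` Rpos R) y -> 0 < x ->
  y <= f x -> geninv (Rpos R) f y <= x.
Proof.
move=> fs Hy x0 yx; have [_ gm _] := geninvP (@Rpos_itv R) fs.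
rewrite -[leRHS](geninvK fs)//; apply: gm => //; rewrite inE //.
exact: hull_val.
Qed.

Lemma geninv_ge (R : realType) (f : R -> R) (x y : R) :
  strictly_increasing_on (Rpos R) f -> conv_hull (f @` Rpos R) y -> 0 < x ->
  f x <= y -> x <= geninv (Rpos R) f y.
Proof.
move=> fs Hy x0 yx; have [_ gm _] := geninvP (@Rpos_itv R) fs.
rewrite -[leLHS](geninvK fs)//; apply: gm => //; rewrite inE //.
exact: hull_val.
Qed.

(** For a monotone function, the oscillation around a is already seen on the
    two endpoints of a symmetric interval, so that continuity arguments reduce
    to linear inequalities between finitely many values. *)
Lemma continuous_at_osc (R : realType) (f : R -> R) (a : R) :
  strictly_increasing_on (Rpos R) f -> 0 < a ->
  {for a, continuous f} <->
  forall e, 0 < e -> exists2 d, 0 < d < a & f (a + d) - f (a - d) < e.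
Proof.
move=> fs a0; split=> [fc e e0|H].
  have /cvgrPdist_lt/(_ (e / 2)) := fc.
  rewrite divr_gt0// => /(_ isT)/nbhs_ballP[r /= r0 H].
  pose d := Num.min (r / 2) (a / 2).
  have d0 : 0 < d by rewrite lt_min !divr_gt0.
  have dr : d < r by rewrite gt_min; apply/orP; left; lra.
  have da : d < a by rewrite gt_min; apply/orP; right; lra.
  exists d; first by rewrite d0.
  have := H (a + d); rewrite /ball/= opprD addNKr normrN gtr0_norm// => /(_ dr).
  have := H (a - d); rewrite /ball/= opprB addrC subrK gtr0_norm// => /(_ dr).
  by rewrite !ltr_norml => /andP[A B] /andP[A' B']; lra.
apply/cvgrPdist_lt => e /H[d /andP[d0 da] fd].
apply/nbhs_ballP; exists d => //= x; rewrite /ball/= ltr_norml => /andP[A B].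
have ad : 0 < a - d by lra.
have x1 : a - d <= x by lra.
have x2 : x <= a + d by lra.
have fx1 := incr_le fs ad x1.
have fx2 := incr_le fs (lt_le_trans ad x1) x2.
have fa1 : f (a - d) <= f a by apply: (incr_le fs) => //; lra.
have fa2 : f a <= f (a + d) by apply: (incr_le fs) => //; lra.
by rewrite ltr_norml; apply/andP; split; lra.
Qed.

(** * Two-point means and the transfer of continuity *)

Definition mean2 (R : realType) (f : R -> R) (x y : R) : R :=
  geninv (Rpos R) f ((f x + f y) / 2).

Lemma hull_mean2 (R : realType) (f : R -> R) (x y : R) :
  0 < x -> 0 < y -> conv_hull (f @` Rpos R) ((f x + f y) / 2).
Proof.
move=> x0 y0.
have -> : (f x + f y) / 2 = 2^-1 * f x + (1 - 2^-1) * f y by field.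
apply: (itv_convex (@hull_itv R _)); [|exact: hull_val|exact: hull_val].
by apply/andP; split; lra.
Qed.

Lemma mean2_le (R : realType) (f : R -> R) (x y z : R) :
  strictly_increasing_on (Rpos R) f -> 0 < x -> 0 < y -> 0 < z ->
  f x + f y <= 2 * f z -> mean2 f x y <= z.
Proof.
by move=> fs x0 y0 z0 H; apply: geninv_le => //; [exact: hull_mean2|lra].
Qed.

Lemma mean2_lt (R : realType) (f : R -> R) (x y z : R) :
  strictly_increasing_on (Rpos R) f -> 0 < x -> 0 < y -> 0 < z ->
  mean2 f x y < z -> f x + f y < 2 * f z.
Proof.
move=> fs x0 y0 z0; apply: contraTT; rewrite -!leNgt => H.
by apply: geninv_ge => //; [exact: hull_mean2|lra].
Qed.

Lemma mean2_id (R : realType) (f : R -> R) (x : R) :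
  strictly_increasing_on (Rpos R) f -> 0 < x -> mean2 f x x = x.
Proof.
move=> fs x0; rewrite /mean2 (_ : (f x + f x) / 2 = f x) ?geninvK//.
by field.
Qed.

(** What the two-point inequality says when a is one addend of the sum p and
    this addend alone is displaced: p - a is the contribution of the others. *)
Definition mean_dominated (R : realType) (h : R -> R) (p : R)
    (f : R -> R) (a : R) :=
  forall s t, - a < s -> - a < t ->
    mean2 h (p + s) (p + t) <= p - a + mean2 f (a + s) (a + t).

(** Take means of a + d and a - eps with d small with respect to eps.  As f is
    continuous at a, they stay below a by a fixed amount; so the means of h at
    p + d and p - eps stay below p.  If h had a jump at p, these means would be
    equal to p for small d and eps: taking the left limit L of h at p as the
    reference value, h (p + d) is forced down to L. *)
Lemma continuous_dominated (R : realType) (h f : R -> R) (p a : R) :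
  strictly_increasing_on (Rpos R) h -> strictly_increasing_on (Rpos R) f ->
  0 < a <= p -> mean_dominated h p f a ->
  {for a, continuous f} -> {for p, continuous h}.
Proof.
move=> hs fs /andP[a0 ap] dom /(continuous_at_osc fs a0) fc.
have p0 : 0 < p by exact: lt_le_trans ap.
apply/(continuous_at_osc hs p0) => e e0.
pose L := sup [set h x | x in [set x | 0 < x < p]].
have Lub x : 0 < x < p -> h x <= L.
  move=> xp; apply: ub_le_sup; last by exists x.
  by exists (h p) => _ [z /andP[z0 zp] <-]; exact/ltW/(incr_lt hs).
have [q /andP[q0 qp] hq] : exists2 q, 0 < q < p & L - e / 2 < h q.
  have /sup_adherent : 0 < e / 2 by lra.
  move=> /(_ [set h x | x in [set x | 0 < x < p]])[|_ [z zp <-] Hz].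
    split; first by exists (h (p / 2)); exists (p / 2) => //=; apply/andP; split; lra.
    by exists (h p) => _ [z /andP[z0 zp] <-]; exact/ltW/(incr_lt hs).
  by exists z.
(* The bound p - q makes h (p - eps) >= h q > L - e / 2; the bound a / 2 keeps
   a - eps positive. *)
pose eps := Num.min (p - q) (a / 2).
have eps0 : 0 < eps by rewrite lt_min; apply/andP; split; lra.
have eps1 : eps <= p - q by rewrite ge_min lexx.
have eps2 : eps <= a / 2 by rewrite ge_min lexx orbT.
(* Half the drop of f from a to a - eps is the oscillation that still leaves
   f (a + d) + f (a - eps) <= 2 * f (a - d0). *)
have e' : 0 < (f a - f (a - eps)) / 2.
  by rewrite divr_gt0// subr_gt0 (incr_lt fs); lra.
have [d0 /andP[d00 d0a] fd0] := fc _ e'.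
pose d := Num.min d0 eps.
have d_gt0 : 0 < d by rewrite lt_min d00.
have dd0 : d <= d0 by rewrite ge_min lexx.
have deps : d <= eps by rewrite ge_min lexx orbT.
have m1 : mean2 f (a + d) (a - eps) <= a - d0.
  apply: mean2_le => //; try lra.
  have : f (a + d) <= f (a + d0) by apply: (incr_le fs); lra.
  have : f (a - d0) <= f a by apply: (incr_le fs); lra.
  have : f a <= f (a + d0) by apply: (incr_le fs); lra.
  lra.
have m2 : mean2 h (p + d) (p - eps) < p - d0 / 2.
  have s1 : - a < d by lra.
  have s2 : - a < - eps by lra.
  by have := dom _ _ s1 s2; lra.
have : h (p + d) + h (p - eps) < 2 * h (p - d0 / 2) by apply: mean2_lt => //; lra.
have : h (p - d0 / 2) <= L by apply: Lub; apply/andP; split; lra.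
have : h q <= h (p - eps) by apply: (incr_le hs); lra.
have : h (p - eps) <= h (p - d) by apply: (incr_le hs); lra.
by exists d; [apply/andP; split; lra|lra].
Qed.

(** If f had a jump at a, then for some fixed d > 0 the mean of f at a + d and
    a - t would be at most a for every t > 0, because f (a - t) is below the
    jump and f (a + d) exceeds the right limit U by less than the jump.  The
    mean of h at p + d and p - t would then be at most p; letting t tend to 0
    contradicts the continuity of h at p, as h (p + d) > h p. *)
Lemma dominated_continuous (R : realType) (h f : R -> R) (p a : R) :
  strictly_increasing_on (Rpos R) h -> strictly_increasing_on (Rpos R) f ->
  0 < a <= p -> mean_dominated h p f a ->
  {for p, continuous h} -> {for a, continuous f}.
Proof.
move=> hs fs /andP[a0 ap] dom hc.
have p0 : 0 < p by exact: lt_le_trans ap.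
have {}hc := (continuous_at_osc hs p0).1 hc.
apply/(continuous_at_osc fs a0) => e e0; apply: contrapT => nf.
have jump d : 0 < d < a -> f (a - d) + e <= f (a + d).
  by move=> da; rewrite leNgt; apply/negP => H; apply: nf; exists d => //; lra.
pose U := inf [set f x | x in [set x | a < x]].
have Ulb x : a < x -> U <= f x.
  move=> xp; apply: ge_inf; last by exists x.
  by exists (f a) => _ [z az <-]; exact/ltW/(incr_lt fs).
have [q aq fq] : exists2 q, a < q & f q < U + e.
  have := @inf_adherent R [set f x | x in [set x | a < x]] e e0.
  case=> [|_ [z zp <-] Hz]; last by exists z.
  split; first by exists (f (a + 1)); exists (a + 1) => //=; lra.
  by exists (f a) => _ [z az <-]; exact/ltW/(incr_lt fs).
pose d := q - a.
have le_a t : 0 < t < a -> mean2 f (a + d) (a - t) <= a.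
  move=> /andP[t0 ta]; apply/ler_addgt0Pr => r r0.
  apply: mean2_le => //; rewrite /d; try lra.
  pose m := Num.min r t.
  have m0 : 0 < m by rewrite lt_min r0.
  have mr : m <= r by rewrite ge_min lexx.
  have mt : m <= t by rewrite ge_min lexx orbT.
  have : f (a - m) + e <= f (a + m) by apply: jump; apply/andP; split; lra.
  have : f (a - t) <= f (a - m) by apply: (incr_le fs); lra.
  have : f (a + m) <= f (a + r) by apply: (incr_le fs); lra.
  have : U <= f (a + r) by apply: Ulb; lra.
  by rewrite (_ : a + (q - a) = q); [lra|ring].
(* The inequalities below give h (p + d) < h p + 2 * e'. *)
pose e' := (h (p + d) - h p) / 3.
have e'0 : 0 < e' by rewrite divr_gt0// subr_gt0 (incr_lt hs)// /d; lra.
have [r /andP[r0 rp] hr] := hc _ e'0.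
pose t := Num.min r (a / 2).
have t0 : 0 < t by rewrite lt_min r0; lra.
have tr : t <= r by rewrite ge_min lexx.
have ta : t <= a / 2 by rewrite ge_min lexx orbT.
have : mean2 h (p + d) (p - t) < p + r.
  have : mean2 f (a + d) (a - t) <= a by apply: le_a; apply/andP; split; lra.
  have s1 : - a < d by rewrite /d; lra.
  have s2 : - a < - t by lra.
  by have := dom _ _ s1 s2; lra.
have d0 : 0 < d by rewrite /d; lra.
move=> m.
have : h (p + d) + h (p - t) < 2 * h (p + r) by apply: mean2_lt => //; lra.
have : h (p - r) <= h (p - t) by apply: (incr_le hs); lra.
have : h (p - r) <= h p by apply: (incr_le hs); lra.
have : h (p + d) = h p + 3 * e' by rewrite /e'; field.
by lra.
Qed.

(** The discontinuities of a monotone function form a countable set, which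
    cannot fill the interval ]1, 2[, of measure 1. *)
Lemma exists_continuity_point (R : realType) (f : R -> R) :
  strictly_increasing_on (Rpos R) f -> exists2 a, 0 < a & {for a, continuous f}.
Proof.
move=> fs.
have fm : {in `[1, 2] &, nondecreasing_fun f}.
  by move=> x y; rewrite !in_itv/= => /andP[x1 _] _; apply: incr_le => //; lra.
have [a a12 na] : exists2 a, a \in `]1, 2[ & ~ discontinuity f a.
  apply: contrapT => H.
  have /countable_lebesgue_measure0 := discontinuity_countable fm.
  rewrite (_ : [set x | _] = `]1, 2[%classic); last first.
    apply/seteqP; split => [x []//|x x12]; split => //.
    by apply: contrapT => nx; apply: H; exists x.
  rewrite lebesgue_measure_itv/= lte_fin ltr1n/= -EFinB => -[] /eqP.
  by rewrite subr_eq0 gt_eqF ?ltr1n.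
have [a1 a2] : 1 < a /\ a < 2 by move: a12; rewrite in_itv/= => /andP[].
have a0 : 0 < a by lra.
exists a => //.
have cl : cvg (f x @[x --> a^'-]).
  apply: nondecreasing_at_left_is_cvgr; near=> r.
    move=> x y; rewrite !in_itv/= => /andP[rx _] _ xy.
    by apply: incr_le => //; apply: lt_trans rx; near: r; exact: nbhs_left_gt.
  exists (f a) => _ [x /= + <-]; rewrite in_itv/= => /andP[rx xa].
  apply: incr_le => //; last exact: ltW.
  by apply: lt_trans rx; near: r; exact: nbhs_left_gt.
have cr : cvg (f x @[x --> a^'+]).
  apply: nondecreasing_at_right_is_cvgr; near=> r.
    move=> x y; rewrite !in_itv/= => /andP[ax _] _ xy.
    by apply: incr_le => //; exact: lt_trans ax.
  exists (f a) => _ [x /= + <-]; rewrite in_itv/= => /andP[ax _].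
  by apply: incr_le => //; exact: ltW.
have eqlr : lim (f x @[x --> a^'-]) = lim (f x @[x --> a^'+]).
  by apply/eqP/negPn/negP => ne; apply: na; split.
have la : lim (f x @[x --> a^'-]) <= f a.
  apply: limr_le => //; near=> x.
  have [x0 xa] : 0 < x /\ x <= a.
    by split; near: x; [exact: nbhs_left_gt|exact: nbhs_left_le].
  exact: incr_le.
have ra : f a <= lim (f x @[x --> a^'+]).
  by apply: limr_ge => //; near=> x; apply: incr_le => //; near: x; exact: nbhs_right_ge.
apply/left_right_continuousP; split.
  suff <- : lim (f x @[x --> a^'-]) = f a by [].
  by apply/le_anti; rewrite la eqlr ra.
suff <- : lim (f x @[x --> a^'+]) = f a by [].
by apply/le_anti; rewrite ra -eqlr la.
Unshelve. all: end_near. Qed.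

(** * Continuity of all the functions *)

(** The two-point inequality (c) in terms of [mean2], the form in which it is
    used and to which (a), (b) and (c) are reduced. *)
Definition sum_mean2_ineq (R : realType) (k : nat) (f : 'I_k.+1 -> R -> R) :=
  forall x y : 'I_k -> R, (forall j, 0 < x j) -> (forall j, 0 < y j) ->
  mean2 (f ord0) (\sum_j x j) (\sum_j y j) <=
    \sum_j mean2 (f (lift ord0 j)) (x j) (y j).

(** Displace the addend x j alone: the other means, of two equal values, are
    constant and cancel. *)
Lemma addend_mean_dominated (R : realType) (k : nat) (f : 'I_k.+1 -> R -> R)
    (x : 'I_k -> R) (j : 'I_k) :
  (forall j, strictly_increasing_on (Rpos R) (f j)) -> sum_mean2_ineq f ->
  (forall j, 0 < x j) ->
  mean_dominated (f ord0) (\sum_j x j) (f (lift ord0 j)) (x j).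
Proof.
move=> fs fc x0 s t sj tj.
pose shift r i := if i == j then x j + r else x i.
have sum_shift r : \sum_i shift r i = \sum_i x i + r.
  rewrite (bigD1 j)//= [in RHS](bigD1 j)//= /shift eqxx addrAC.
  by congr (_ + _ + _); apply: eq_bigr => i /negPf ->.
have shift0 r : - x j < r -> forall i, 0 < shift r i.
  by move=> rj i; rewrite /shift; case: ifP => // _; lra.
have := fc _ _ (shift0 _ sj) (shift0 _ tj).
rewrite !sum_shift => /le_trans; apply.
rewrite (bigD1 j)//= [in leRHS](bigD1 j)//= /shift eqxx.
rewrite [x j + \sum_(_ < _ | _) _]addrC addrK [leRHS]addrC lerD2l.
by apply: ler_sum => i /negPf ->; rewrite mean2_id.
Qed.

Lemma sum_ge_term (R : realType) (k : nat) (x : 'I_k -> R) (j : 'I_k) :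
  (forall j, 0 < x j) -> 0 < x j <= \sum_j x j.
Proof.
move=> x0; rewrite x0 (bigD1 j)//= lerDl sumr_ge0// => i _; exact: ltW.
Qed.

Lemma sum_pos (R : realType) (k : nat) (x : 'I_k -> R) :
  (0 < k)%N -> (forall j, 0 < x j) -> 0 < \sum_j x j.
Proof.
move=> k0 x0; have /andP[j0 jS] := sum_ge_term (Ordinal k0) x0.
exact: lt_le_trans jS.
Qed.

Lemma addend_continuousP (R : realType) (k : nat) (f : 'I_k.+1 -> R -> R)
    (x : 'I_k -> R) (j : 'I_k) :
  (forall j, strictly_increasing_on (Rpos R) (f j)) -> sum_mean2_ineq f ->
  (forall j, 0 < x j) ->
  {for x j, continuous (f (lift ord0 j))} <->
  {for \sum_j x j, continuous (f ord0)}.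
Proof.
move=> fs fc x0; have dom := addend_mean_dominated (x := x) (j := j) fs fc x0.
have xj := sum_ge_term j x0.
by split; [exact: continuous_dominated dom|exact: dominated_continuous dom].
Qed.

(** Continuity everywhere passes from an addend function to f_0, writing x as
    a sum of k equal terms, and from f_0 to all addend functions. *)
Lemma continuity_spreads (R : realType) (k : nat) (f : 'I_k.+1 -> R -> R) :
  (0 < k)%N ->
  (forall j, strictly_increasing_on (Rpos R) (f j)) -> sum_mean2_ineq f ->
  (exists j, forall x, 0 < x -> {for x, continuous (f j)}) ->
  forall j x, 0 < x -> {for x, continuous (f j)}.
Proof.
move=> k0 fs fc [j0 cj0].
have c0 x : 0 < x -> {for x, continuous (f ord0)}.
  case: (unliftP ord0 j0) cj0 => [j|] -> cj x0; last exact: cj.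
  have xk0 : 0 < x / k%:R by rewrite divr_gt0 ?ltr0n.
  have -> : x = \sum_(i < k) x / k%:R.
    by rewrite sumr_const card_ord -[RHS]mulr_natr divfK// pnatr_eq0 -lt0n.
  by apply/(addend_continuousP (x := fun=> x / k%:R) j fs fc) => //; exact: cj.
move=> j x x0; case: (unliftP ord0 j) => [j'|] ->; last exact: c0.
apply/(addend_continuousP (x := fun=> x) j' fs fc) => //; apply: c0.
have /andP[_] := sum_ge_term (x := fun=> x) j' (fun=> x0).
exact: lt_le_trans.
Qed.

(** For k >= 2, evaluate the sum with first addend a, a continuity point of its
    function, and all others equal to an arbitrary z: continuity goes from a up
    to the sum, and back down to z. *)
Lemma sum_mean2_continuous (R : realType) (k : nat) (f : 'I_k.+1 -> R -> R) :
  (0 < k)%N -> (k = 1%N -> exists j, forall x, 0 < x -> {for x, continuous (f j)}) ->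
  (forall j, strictly_increasing_on (Rpos R) (f j)) -> sum_mean2_ineq f ->
  forall j x, 0 < x -> {for x, continuous (f j)}.
Proof.
move=> k0 k1 fs fc; apply: continuity_spreads => //.
have [/k1//|kn1] := eqVneq k 1%N.
have k2 : (1 < k)%N by rewrite ltn_neqAle eq_sym kn1.
pose i0 := Ordinal k0; pose i1 := Ordinal k2.
have [a a0 fa] := exists_continuity_point (fs (lift ord0 i0)).
exists (lift ord0 i1) => z z0.
pose x i := if i == i0 then a else z.
have x0 i : 0 < x i by rewrite /x; case: ifP.
by apply/(addend_continuousP (x := x) i1 fs fc x0)/(addend_continuousP (x := x) i0 fs fc x0).
Qed.

(** * Inverses of continuous functions and concavity *)

Lemma image_itv (R : realType) (f : R -> R) :
  strictly_increasing_on (Rpos R) f ->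
  (forall x, 0 < x -> {for x, continuous f}) -> is_interval (f @` Rpos R).
Proof.
move=> fs fc _ _ [a a0 <-] [b b0 <-] y /andP[ay yb].
have ab : a <= b.
  rewrite leNgt; apply/negP => ba; have := incr_lt fs b0 ba.
  by rewrite ltNge (le_trans ay yb).
have cab : {within `[a, b], continuous f}.
  apply: continuous_in_subspaceT => x; rewrite inE/= in_itv/= => /andP[ax _].
  by apply: fc; exact: lt_le_trans ax.
have [|c] := IVT (v := y) ab cab.
  by rewrite ge_min le_max ay yb orbT.
rewrite in_itv/= => /andP[ac _] <-; exists c => //.
by apply: lt_le_trans ac.
Qed.

Lemma hull_image (R : realType) (f : R -> R) (y : R) :
  strictly_increasing_on (Rpos R) f ->
  (forall x, 0 < x -> {for x, continuous f}) ->
  conv_hull (f @` Rpos R) y -> exists2 x, 0 < x & f x = y.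
Proof.
move=> fs fc /conv_hullP[u [v [Su Sv uyv]]].
exact: (image_itv fs fc Su Sv uyv).
Qed.

Lemma geninvKV (R : realType) (f : R -> R) (y : R) :
  strictly_increasing_on (Rpos R) f ->
  (forall x, 0 < x -> {for x, continuous f}) ->
  conv_hull (f @` Rpos R) y -> f (geninv (Rpos R) f y) = y.
Proof. by move=> fs fc /(hull_image fs fc)[x x0 <-]; rewrite geninvK. Qed.

(** The values f (x - d) and f (x + d) bracket f x strictly, and the inverse
    maps everything between them into [x - d, x + d].  A jump of f makes the
    inverse constant over the gap, not discontinuous. *)
Lemma continuous_geninv (R : realType) (f : R -> R) (x : R) :
  strictly_increasing_on (Rpos R) f -> 0 < x ->
  {for f x, continuous (geninv (Rpos R) f)}.
Proof.
move=> fs x0; apply/cvgrPdist_lt => e e0; rewrite geninvK//.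
pose d := Num.min (e / 2) (x / 2).
have d0 : 0 < d by rewrite lt_min !divr_gt0.
have de : d <= e / 2 by rewrite ge_min lexx.
have dx : d <= x / 2 by rewrite ge_min lexx orbT.
have fl : f (x - d) < f x by apply: incr_lt => //; lra.
have fr : f x < f (x + d) by apply: incr_lt => //; lra.
near=> y.
have yl : f (x - d) < y by near: y; exact: lt_nbhsr.
have yr : y < f (x + d) by near: y; exact: lt_nbhsl.
have Hy : conv_hull (f @` Rpos R) y.
  apply/conv_hullP; exists (f (x - d)), (f (x + d)).
  by rewrite !ltW//; split => //; [exists (x - d)|exists (x + d)] => //; rewrite /Rpos/=; lra.
have : x - d <= geninv (Rpos R) f y by apply: geninv_ge => //; lra.
have : geninv (Rpos R) f y <= x + d by apply: geninv_le => //; lra.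
by rewrite ltr_norml => A B; apply/andP; split; lra.
Unshelve. all: end_near. Qed.

Lemma continuous_chord (R : realType) (p q : R) :
  continuous (fun s : R => s * p + (1 - s) * q).
Proof.
move=> r; apply: cvgD; apply: cvgM; try exact: cvg_cst; first exact: cvg_id.
by apply: cvgB; [exact: cvg_cst|exact: cvg_id].
Qed.

(** Subtract the chord and let c be a minimum point of the difference h, which
    vanishes at 0 and 1.  The point c is the midpoint of one of the endpoints
    and a second point of [0, 1], where h is at least h c; hence
    0 + h c <= 2 * h c, that is 0 <= h c. *)
Lemma midpoint_concave_chord (R : realType) (phi : R -> R) :
  {within `[0, 1], continuous phi} ->
  (forall s t, 0 <= s <= 1 -> 0 <= t <= 1 ->
    phi s + phi t <= 2 * phi ((s + t) / 2)) ->
  forall t, 0 <= t <= 1 -> t * phi 1 + (1 - t) * phi 0 <= phi t.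
Proof.
move=> phic phim t t01.
pose h s := phi s - (s * phi 1 + (1 - s) * phi 0).
have hm s r : 0 <= s <= 1 -> 0 <= r <= 1 -> h s + h r <= 2 * h ((s + r) / 2).
  by move=> s01 r01; rewrite /h; have := phim _ _ s01 r01; lra.
have hc : {within `[0, 1], continuous h}.
  by move=> s; apply: cvgB; [exact: phic|exact: (continuous_subspaceT (@continuous_chord R _ _))].
have [c c01 cmin] := EVT_min ler01 hc.
have {}c01 : 0 <= c <= 1 by rewrite in_itv/= in c01.
have {}cmin s : 0 <= s <= 1 -> h c <= h s by move=> s01; apply: cmin; rewrite in_itv.
suff hc0 : 0 <= h c by have := cmin _ t01; rewrite /h in hc0 *; lra.
have h0 : h 0 = 0 by rewrite /h; ring.
have h1 : h 1 = 0 by rewrite /h; ring.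
have [c2|c2] := leP c 2^-1.
  have s01 : 0 <= 2 * c <= 1 by apply/andP; split; lra.
  have := hm 0 (2 * c); rewrite h0 (_ : (0 + 2 * c) / 2 = c); last by field.
  have := cmin _ s01; rewrite s01 lexx ler01 => A /(_ isT isT); lra.
have s01 : 0 <= 2 * c - 1 <= 1 by apply/andP; split; lra.
have := hm 1 (2 * c - 1); rewrite h1 (_ : (1 + (2 * c - 1)) / 2 = c); last by field.
by have := cmin _ s01; rewrite s01 lexx ler01 => A /(_ isT isT); lra.
Qed.

Lemma incr_inj (R : realType) (f : R -> R) :
  strictly_increasing_on (Rpos R) f -> {in Rpos R &, injective f}.
Proof.
move=> fs x y; rewrite !inE => x0 y0 fxy.
have [xy|yx|//] := ltgtP x y.
  by have := incr_lt fs x0 xy; rewrite fxy ltxx.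
by have := incr_lt fs y0 yx; rewrite fxy ltxx.
Qed.

Lemma Psi_geninv (R : realType) (k : nat) (f : 'I_k.+1 -> R -> R)
    (u : 'rV[R]_k) :
  (forall j, strictly_increasing_on (Rpos R) (f j)) -> Psi_dom f u ->
  Psi f u = f ord0 (\sum_j geninv (Rpos R) (f (lift ord0 j)) (u ord0 j)).
Proof.
move=> fs Du; congr (f ord0 _); apply: eq_bigr => j _.
have [x x0 <-] := Du j; rewrite geninvK// pinvKV ?inE//; exact: incr_inj.
Qed.

Lemma Psi_dom_convex (R : realType) (k : nat) (f : 'I_k.+1 -> R -> R) :
  (forall j, strictly_increasing_on (Rpos R) (f j)) ->
  (forall j x, 0 < x -> {for x, continuous (f j)}) ->
  forall u v t, 0 <= t <= 1 -> Psi_dom f u -> Psi_dom f v ->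
    Psi_dom f (t *: u + (1 - t) *: v).
Proof.
move=> fs fc u v t t01 Du Dv j; rewrite !mxE.
by apply: (itv_convex (image_itv (fs _) (fc _))).
Qed.

Lemma sum_geninv_gt0 (R : realType) (k : nat) (f : 'I_k.+1 -> R -> R)
    (u : 'rV[R]_k) :
  (0 < k)%N -> (forall j, strictly_increasing_on (Rpos R) (f j)) ->
  Psi_dom f u ->
  0 < \sum_j geninv (Rpos R) (f (lift ord0 j)) (u ord0 j).
Proof.
move=> k0 fs Du; apply: sum_pos => // j.
by apply: geninv_gt0 => //; exact: hull_sub.
Qed.

Lemma geninv_leE (R : realType) (f : R -> R) (y x : R) :
  strictly_increasing_on (Rpos R) f ->
  (forall x, 0 < x -> {for x, continuous f}) ->
  conv_hull (f @` Rpos R) y -> 0 < x ->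
  (geninv (Rpos R) f y <= x) = (y <= f x).
Proof.
move=> fs fc Hy x0; apply/idP/idP => [gx|]; last exact: geninv_le.
rewrite -(geninvKV fs fc Hy); apply: incr_le => //; exact: geninv_gt0.
Qed.

(** At the points g_j (w_s) and g_j (w_r), the two-point inequality is midpoint
    concavity of Psi along the segment w, after applying the increasing f_0; there, Psi is
    a continuous function of one variable. *)
Lemma Psi_concave (R : realType) (k : nat) (f : 'I_k.+1 -> R -> R) :
  (0 < k)%N -> (forall j, strictly_increasing_on (Rpos R) (f j)) ->
  (forall j x, 0 < x -> {for x, continuous (f j)}) -> sum_mean2_ineq f ->
  concave_function (Psi_dom f) (Psi f).
Proof.
move=> k0 fs fc fm t t01 u v; rewrite !inE => Du Dv.
pose w s := s *: u + (1 - s) *: v.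
have Dw s : 0 <= s <= 1 -> Psi_dom f (w s).
  by move=> s01; exact: Psi_dom_convex.
pose phi s := Psi f (w s).
have -> : Psi f u = phi 1 by rewrite /phi /w scale1r subrr scale0r addr0.
have -> : Psi f v = phi 0 by rewrite /phi /w scale0r subr0 scale1r add0r.
pose g j := geninv (Rpos R) (f (lift ord0 j)).
pose inner s := \sum_j g j (s * u ord0 j + (1 - s) * v ord0 j).
pose psi s := f ord0 (inner s).
have phiE s : 0 <= s <= 1 -> phi s = psi s.
  move=> s01; rewrite /phi Psi_geninv//; last exact: Dw.
  by congr (f ord0 _); apply: eq_bigr => j _; rewrite !mxE.
rewrite -/(phi t) !phiE ?lexx ?ler01//.
move: t t01; apply: midpoint_concave_chord => [|s r s01 r01].
  apply: continuous_in_subspaceT => s; rewrite inE/= in_itv/= => s01.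
  have S0 : 0 < inner s.
    have := sum_geninv_gt0 k0 fs (Dw _ s01).
    by under eq_bigr do rewrite !mxE.
  apply: (@continuous_comp _ _ _ inner (f ord0)); last exact: fc.
  apply: cvg_big => [|j _]; first exact: add_continuous.
  have gc : {for s * u ord0 j + (1 - s) * v ord0 j, continuous (g j)}.
    have := Dw _ s01 j; rewrite !mxE => -[x x0 <-]; exact: continuous_geninv.
  exact: (continuous_comp (@continuous_chord R (u ord0 j) (v ord0 j) s) gc).
have sr01 : 0 <= (s + r) / 2 <= 1 by lra.
rewrite -!phiE// /phi !Psi_geninv//; try exact: Dw.
have gw0 q j : 0 <= q <= 1 -> 0 < g j (w q ord0 j).
  by move=> q01; apply: geninv_gt0 => //; apply: hull_sub; exact: Dw.
have := fm _ _ (fun j => gw0 s j s01) (fun j => gw0 r j r01).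
have -> : \sum_j mean2 (f (lift ord0 j)) (g j (w s ord0 j)) (g j (w r ord0 j)) =
    \sum_j g j (w ((s + r) / 2) ord0 j).
  apply: eq_bigr => j _; rewrite /mean2 !(geninvKV (fs _) (fc _))//;
    try by apply: hull_sub; exact: Dw.
  by congr geninv; rewrite !mxE; field.
rewrite /mean2 (geninv_leE (fs _) (fc _))//.
- by move=> H; rewrite mulrC -ler_pdivrMr.
- apply: hull_mean2; apply: sum_geninv_gt0 => //; exact: Dw.
- by apply: sum_geninv_gt0 => //; exact: Dw.
Qed.

(** The hypograph of F is convex, hence contains the barycenters of the points
    (v i, F (v i)). *)
Lemma jensen (R : realType) (E : lmodType R) (D : set E) (F : E -> R) :
  (forall u v t, 0 <= t <= 1 -> D u -> D v -> D (t *: u + (1 - t) *: v)) ->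
  (forall u v t, 0 <= t <= 1 -> D u -> D v ->
    t * F u + (1 - t) * F v <= F (t *: u + (1 - t) *: v)) ->
  forall n (l : 'I_n -> R) (v : 'I_n -> E),
    (forall i, 0 <= l i) -> (forall i, D (v i)) -> 0 < \sum_i l i ->
    D ((\sum_i l i)^-1 *: \sum_i l i *: v i) /\
    (\sum_i l i * F (v i)) / \sum_i l i <=
      F ((\sum_i l i)^-1 *: \sum_i l i *: v i).
Proof.
move=> cD cF n l v l0 Dv s0.
pose H := [set p : E * R^o | D p.1 /\ p.2 <= F p.1].
have cH p q t : 0 <= t <= 1 -> H p -> H q -> H (t *: p + (1 - t) *: q).
  move=> /[dup] t01 /andP[t0 t1] [Dp Fp] [Dq Fq]; split; first exact: cD.
  apply: le_trans (cF _ _ _ t01 Dp Dq).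
  by apply: lerD; apply: ler_wpM2l => //; rewrite subr_ge0.
have := convex_barycenter cH (v := fun i => (v i, F (v i) : R^o)) l0 _ s0.
have -> : \sum_i l i *: (v i, F (v i) : R^o) =
    (\sum_i l i *: v i, \sum_i l i * F (v i) : R^o).
  by apply: (big_rec3 (fun a b c => a = (b, c))) => // i a b c _ ->.
rewrite [_ / _]mulrC; apply => i; split => /=; first exact: Dv.
exact: lexx.
Qed.

(** * From Psi to the mean inequalities, and back *)

Lemma weights_sum_gt0 (R : realType) (n : nat) (l : n.-tuple R) :
  weights R n l -> 0 < \sum_i tnth l i.
Proof.
move=> [l0 ln0]; rewrite lt_def sumr_ge0// andbT.
apply/eqP => /psumr_eq0P H; apply: ln0; apply: eq_from_tnth => i.
by rewrite tnth_mktuple H.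
Qed.

(** Jensen's inequality for Psi at the rows (f_j (x i j))_j bounds the weighted
    mean of the values of f_0 by the value of f_0 at the sum of the means. *)
Lemma wqamean_sum_le (R : realType) (k : nat) (f : 'I_k.+1 -> R -> R) :
  (0 < k)%N -> (forall j, strictly_increasing_on (Rpos R) (f j)) ->
  (forall j x, 0 < x -> {for x, continuous (f j)}) ->
  concave_function (Psi_dom f) (Psi f) ->
  forall (n : nat) (x : 'I_n -> 'I_k -> R) (l : n.-tuple R),
    (forall i j, Rpos R (x i j)) -> weights R n l ->
    wqamean (Rpos R) (f ord0) [tuple \sum_(j < k) x i j | i < n] l <=
      \sum_(j < k) wqamean (Rpos R) (f (lift ord0 j)) [tuple x i j | i < n] l.
Proof.
move=> k0 fs fc Pc n x l x0 wl.
have l0 := weights_sum_gt0 wl.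
pose v i := \row_j f (lift ord0 j) (x i j).
have Dv i : Psi_dom f (v i) by move=> j; rewrite mxE; exists (x i j).
have cF u w t : 0 <= t <= 1 -> Psi_dom f u -> Psi_dom f w ->
    t * Psi f u + (1 - t) * Psi f w <= Psi f (t *: u + (1 - t) *: w).
  by move=> t01 Du Dw; apply: Pc; rewrite ?inE.
have [] := jensen (Psi_dom_convex fs fc) cF wl.1 Dv l0.
set m := (_ *: _) => Dm.
have -> : \sum_i tnth l i * Psi f (v i) =
    \sum_i tnth l i * f ord0 (\sum_j x i j).
  apply: eq_bigr => i _; rewrite Psi_geninv//.
  by congr (_ * f ord0 _); apply: eq_bigr => j _; rewrite mxE geninvK//; exact: x0.
have -> : \sum_j wqamean (Rpos R) (f (lift ord0 j)) [tuple x i j | i < n] l =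
    \sum_j geninv (Rpos R) (f (lift ord0 j)) (m ord0 j).
  apply: eq_bigr => j _; rewrite /wqamean /m mxE summxE mulrC.
  by congr (geninv _ _ (_ * _)); apply: eq_bigr => i _; rewrite !mxE tnth_mktuple.
rewrite Psi_geninv// => H; rewrite /wqamean.
under eq_bigr do rewrite tnth_mktuple.
apply: geninv_le => //; last exact: sum_geninv_gt0.
apply: hull_mean => // [|i]; first exact: wl.1.
exists (\sum_j x i j) => //.
exact: sum_pos (x0 i).
Qed.

Lemma wqamean_unit_weights (R : realType) (f : R -> R) (n : nat)
    (x : n.-tuple R) :
  wqamean (Rpos R) f x [tuple 1 | _ < n] = qamean (Rpos R) f x.
Proof.
rewrite /wqamean /qamean; congr (geninv _ _ (_ / _)).
  by apply: eq_bigr => i _; rewrite tnth_mktuple mul1r.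
under eq_bigr do rewrite tnth_mktuple.
by rewrite sumr_const card_ord.
Qed.

Lemma unit_weights (R : realType) (n : nat) :
  (0 < n)%N -> weights R n [tuple 1 | _ < n].
Proof.
move=> n0; split => [i|]; first by rewrite tnth_mktuple.
move/(congr1 (fun t => tnth t (Ordinal n0))); rewrite !tnth_mktuple => /eqP.
by rewrite oner_eq0.
Qed.

Lemma qamean_pair (R : realType) (f : R -> R) (x : 2.-tuple R) :
  qamean (Rpos R) f x = mean2 f (tnth x ord0) (tnth x (lift ord0 ord0)).
Proof. by rewrite /qamean !big_ord_recl big_ord0 addr0. Qed.

Lemma sum_mean2_of_qamean (R : realType) (k : nat) (f : 'I_k.+1 -> R -> R) :
  (forall x : 'I_2 -> 'I_k -> R, (forall i j, Rpos R (x i j)) ->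
    qamean (Rpos R) (f ord0) [tuple \sum_(j < k) x i j | i < 2] <=
      \sum_(j < k) qamean (Rpos R) (f (lift ord0 j)) [tuple x i j | i < 2]) ->
  sum_mean2_ineq f.
Proof.
move=> H x y x0 y0.
have := H (fun i => if i == ord0 then x else y).
rewrite qamean_pair !tnth_mktuple /=.
under [leRHS]eq_bigr do rewrite qamean_pair !tnth_mktuple /=.
by apply => i j; case: ifP => _; [exact: x0|exact: y0].
Qed.

Unset Implicit Arguments.

Theorem corollary3p3 (R : realType) (k : nat) (f : 'I_k.+1 -> R -> R)
    (k_gt0 : (0 < k)%N)
    (f_incr : forall j, strictly_increasing_on (Rpos R) (f j))
    (* Automatic for k >= 2.  For k = 1 and f_0 = f_1 discontinuous, (a), (b),
       (c) hold and (d) fails. *)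
    (k1_cont : k = 1%N -> exists j, {within Rpos R, continuous (f j)}) :
  [<->
    (* (a) *)
    forall (n : nat) (x : 'I_n -> 'I_k -> R), (0 < n)%N ->
      (forall i j, Rpos R (x i j)) ->
      qamean (Rpos R) (f ord0) [tuple \sum_(j < k) x i j | i < n] <=
        \sum_(j < k) qamean (Rpos R) (f (lift ord0 j)) [tuple x i j | i < n];
    (* (b) *)
    forall (n : nat) (x : 'I_n -> 'I_k -> R) (l : n.-tuple R), (0 < n)%N ->
      (forall i j, Rpos R (x i j)) -> weights R n l ->
      wqamean (Rpos R) (f ord0) [tuple \sum_(j < k) x i j | i < n] l <=
        \sum_(j < k)
          wqamean (Rpos R) (f (lift ord0 j)) [tuple x i j | i < n] l;
    (* (c) *)
    forall x y : 'I_k -> R,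
      (forall j, Rpos R (x j)) -> (forall j, Rpos R (y j)) ->
      qamean (Rpos R) (f ord0) [tuple \sum_(j < k) x j; \sum_(j < k) y j] <=
        \sum_(j < k) qamean (Rpos R) (f (lift ord0 j)) [tuple x j; y j];
    (* (d) *)
    (forall j, {within Rpos R, continuous (f j)}) /\
      concave_function (Psi_dom f) (Psi f)
  ].
Proof.
have contE j : {within Rpos R, continuous (f j)} <->
    forall x, 0 < x -> {for x, continuous (f j)}.
  rewrite (continuous_open_subspace _ (@open_Rpos R)).
  by split=> H x x0; apply: H; rewrite ?inE// in x0 *.
have c_cont : sum_mean2_ineq f -> forall j x, 0 < x -> {for x, continuous (f j)}.
  apply: sum_mean2_continuous => //.
  by move=> /k1_cont[j /contE cj]; exists j.
have c_conc fm := Psi_concave k_gt0 f_incr (c_cont fm) fm.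
have c_b fm := wqamean_sum_le k_gt0 f_incr (c_cont fm) (c_conc fm).
tfae.
- by move=> a n x l n0; apply: c_b; apply: sum_mean2_of_qamean => x'; exact: a.
- move=> b; have fm : sum_mean2_ineq f.
    apply: sum_mean2_of_qamean => x x0; have := b 2 x _ isT x0 (@unit_weights R 2 isT).
    rewrite wqamean_unit_weights.
    by under [leRHS]eq_bigr do rewrite wqamean_unit_weights.
  move=> x y x0 y0; rewrite qamean_pair; under [leRHS]eq_bigr do rewrite qamean_pair.
  exact: fm.
- move=> c; have fm : sum_mean2_ineq f.
    move=> x y x0 y0; have := c x y x0 y0.
    by rewrite qamean_pair; under [leRHS]eq_bigr do rewrite qamean_pair.
  by split => [j|]; [apply/contE; exact: c_cont|exact: c_conc].
- move=> [cf conc] n x n0 x0.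
  have fc j := (contE j).1 (cf j).
  have := wqamean_sum_le k_gt0 f_incr fc conc x0 (@unit_weights R n n0).
  rewrite wqamean_unit_weights.
  by under [leRHS]eq_bigr do rewrite wqamean_unit_weights.
Qed.
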